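(* Let $k$ be an algebraically closed field of characteristic $p>0$ and let $H$ be a finite-dimensional pointed Hopf algebra over $k$ with $H\neq H_0$. Let $a$ be a skew point of $H$ and suppose that $p$ does not divide the order of $a$. Then there is an element $x\in P_{a,1}\setminus H_0$ such that $axa^{-1}=qx$ for a primitive $N$-th root of unity $q\in k^*$ (for some $N\ge1$). If $q\neq1$ and $H$ is of rank one, then $x$ is uniquely determined up to scalar multiples by these properties.
   Context: For a finite-dimensional Hopf algebra $H$ over $k$: $G(H)$ is the group of group-like elements; the coradical $H_0$ is the sum of the simple subcoalgebras; $H_1=\Delta^{-1}(H\otimes H_0+H_0\otimes H)$. $H$ is pointed if all simple subcoalgebras are one-dimensional, so that $H_0=kG(H)$. For $g,h\in G(H)$, $P_{g,h}=\{c\in H:\Delta(c)=c\otimes g+h\otimes c\}$. An element $a\in G(H)$ is a skew point if $P_{a,1}\setminus H_0\neq\emptyset$. A pointed $H$ has rank $t$ if $\dim_k k\otimes_{H_0}H_1=t+1$ ($k$ trivial via the counit). *)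

(* Defs.v *)
From HB Require Import structures.
From mathcomp Require Import all_boot all_order all_algebra all_field.
From mathcomp Require Import boolp.

Set Implicit Arguments.
Unset Strict Implicit.
Unset Printing Implicit Defensive.

Import GRing.Theory.
Local Open Scope ring_scope.

Section Sums.
Variables (k : fieldType) (V : vectType k).
Implicit Types (P : {vspace V} -> Prop) (X : V -> Prop).

Lemma sumvs_ex P : exists s : seq {vspace V},
  (forall C, C \in s -> P C) /\
  (forall C, P C -> (C <= \sum_(D <- s) D)%VS).
Proof.
suff grow n : forall s : seq {vspace V}, (forall C, C \in s -> P C) ->
    (\dim {:V} - \dim (\sum_(D <- s) D)%VS < n)%N ->
    exists s : seq {vspace V}, (forall C, C \in s -> P C) /\
      (forall C, P C -> (C <= \sum_(D <- s) D)%VS).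
  exact: (grow _ [::] _ (ltnSn _)).
elim: n => [//|n IHn] s sP lt_n.
have [|/existsNP[C /not_implyP[PC /negP CNs]]] :=
  pselect (forall C, P C -> (C <= \sum_(D <- s) D)%VS); first by exists s.
apply: (IHn (C :: s)) => [D|]; first by rewrite inE => /predU1P[->|/sP].
have lt_dim : (\dim (\sum_(D <- s) D)%VS < \dim (\sum_(D <- C :: s) D)%VS)%N.
  rewrite big_cons (ltn_leqif (dimv_leqif_sup (addvSr C _))).
  by rewrite subv_add subvv andbT.
rewrite ltnS in lt_n; apply: leq_trans _ lt_n; rewrite ltn_sub2l //.
by apply: leq_trans lt_dim _; rewrite dimvS ?subvf.
Qed.

Definition sumvs P : {vspace V} := (\sum_(C <- sval (cid (sumvs_ex P))) C)%VS.

Lemma sumvs_sup P C : P C -> (C <= sumvs P)%VS.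
Proof. exact: (svalP (cid (sumvs_ex P))).2. Qed.

Lemma sumvs_sub P (W : {vspace V}) :
  (forall C, P C -> (C <= W)%VS) -> (sumvs P <= W)%VS.
Proof.
move=> PW; rewrite /sumvs big_seq.
elim/big_ind: _ => [|A B AW BW|C sC]; first exact: sub0v.
  by rewrite subv_add AW.
exact/PW/(svalP (cid (sumvs_ex P))).1.
Qed.

Definition span_set X : {vspace V} :=
  sumvs (fun L => exists2 v, X v & L = <[v]>%VS).

End Sums.

(* U (x) V is modelled by coordinate matrices in the bases vbasis {:U} and   *)
(* vbasis {:V}; tens_bilinear and tlift_tens below give its universal        *)
(* property.                                                                 *)
Definition tensor (k : fieldType) (U V : vectType k) : vectType k :=
  'M[k]_(\dim {:U}, \dim {:V}).

Section Tensor.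
Variables (k : fieldType) (U V : vectType k).

Definition tens (u : U) (v : V) : tensor U V :=
  \matrix_(i, j) (coord (vbasis {:U}) i u * coord (vbasis {:V}) j v).

Definition tlift (W : vectType k) (B : U -> V -> W) (t : tensor U V) : W :=
  \sum_i \sum_j t i j *: B (vbasis {:U})`_i (vbasis {:V})`_j.

Definition bilinear_map (W : lmodType k) (B : U -> V -> W) : Prop :=
  (forall v, linear (B^~ v)) /\ (forall u, linear (B u)).

Lemma tens_bilinear : bilinear_map tens.
Proof.
split=> [v c u u'|u c v v']; apply/matrixP=> i j; rewrite !mxE linearP /=.
  by rewrite mulrDl mulrA.
by rewrite mulrDr mulrCA.
Qed.

Lemma tlift_linear (W : vectType k) (B : U -> V -> W) : linear (tlift B).
Proof.
move=> c s t; rewrite /tlift scaler_sumr -big_split; apply: eq_bigr => i _ /=.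
rewrite scaler_sumr -big_split; apply: eq_bigr => j _ /=.
by rewrite !mxE scalerDl scalerA.
Qed.

Lemma tlift_tens (W : vectType k) (B : U -> V -> W) u v :
  bilinear_map B -> tlift B (tens u v) = B u v.
Proof.
move=> [Bl Br].
have suml I (r : seq I) (c : I -> k) (f : I -> U) w :
    B (\sum_(i <- r) c i *: f i) w = \sum_(i <- r) c i *: B (f i) w.
  elim: r => [|i r IHr]; last by rewrite !big_cons Bl IHr.
  rewrite !big_nil; apply: (@addrI _ (B 0 w)); have := Bl w 1 0 0.
  by rewrite /= !scale1r !addr0 => <-.
have sumr I (r : seq I) (c : I -> k) (f : I -> V) w :
    B w (\sum_(i <- r) c i *: f i) = \sum_(i <- r) c i *: B w (f i).
  elim: r => [|i r IHr]; last by rewrite !big_cons Br IHr.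
  rewrite !big_nil; apply: (@addrI _ (B w 0)); have := Br w 1 0 0.
  by rewrite !scale1r !addr0 => <-.
rewrite [in RHS](coord_vbasis (memvf u)) [in RHS](coord_vbasis (memvf v)) suml.
apply: eq_bigr => i _; rewrite sumr scaler_sumr; apply: eq_bigr => j _.
by rewrite mxE scalerA.
Qed.

Lemma tens_span (t : tensor U V) :
  t = \sum_i \sum_j t i j *: tens (vbasis {:U})`_i (vbasis {:V})`_j.
Proof.
have fr (W : vectType k) (i j : 'I_(\dim {:W})) :
    coord (vbasis {:W}) j (vbasis {:W})`_i = (i == j)%:R.
  by rewrite coord_free ?(basis_free (vbasisP _)) // eq_sym.
rewrite [LHS]matrix_sum_delta; apply: eq_bigr => i _; apply: eq_bigr => j _.
congr (_ *: _); apply/matrixP=> a b; rewrite !mxE !fr -natrM mulnb.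
by rewrite eq_sym [b == j]eq_sym.
Qed.

Definition tensv (A : {vspace U}) (B : {vspace V}) : {vspace tensor U V} :=
  span_set (fun t => exists u v, [/\ u \in A, v \in B & t = tens u v]).

End Tensor.

Notation "u ⊗ v" := (tens u v) (at level 40, left associativity) : ring_scope.

Section TensorMaps.
Variable k : fieldType.

Definition tmap (U V U' V' : vectType k) (f : U -> U') (g : V -> V') :
    tensor U V -> tensor U' V' :=
  tlift (fun u v => f u ⊗ g v).

Definition tassoc (U V W : vectType k) :
    tensor (tensor U V) W -> tensor U (tensor V W) :=
  tlift (fun t w => tlift (fun u v => u ⊗ (v ⊗ w)) t).

(* The product of A (x) A, (a (x) b)(c (x) d) = ac (x) bd.                   *)
Definition tmul (A : falgType k) (s t : tensor A A) : tensor A A :=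
  tlift (fun a b => tlift (fun c d => (a * c) ⊗ (b * d)) t) s.

End TensorMaps.

HB.mixin Record isCoalgebra (k : fieldType) C of Vector k C := {
  comul : 'Hom(C, tensor C C);
  counit : 'Hom(C, k^o);
  comulA : forall x : C,
    tassoc (tmap comul idfun (comul x)) = tmap idfun comul (comul x);
  counit_comull : forall x : C,
    tlift (fun u v => counit u *: v) (comul x) = x;
  counit_comulr : forall x : C,
    tlift (fun u v => counit v *: u) (comul x) = x
}.

#[short(type="coalgType")]
HB.structure Definition Coalgebra (k : fieldType) :=
  { C of isCoalgebra k C & Vector k C }.

HB.mixin Record isBialgebra (k : fieldType) H
    of Falgebra k H & Coalgebra k H := {
  comul1 : comul (1 : H) = 1 ⊗ 1;
  comulM : forall x y : H, comul (x * y) = tmul (comul x) (comul y);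
  counit1 : counit (1 : H) = 1;
  counitM : forall x y : H, counit (x * y) = counit x * counit y
}.

#[short(type="bialgType")]
HB.structure Definition Bialgebra (k : fieldType) :=
  { H of isBialgebra k H & Falgebra k H & Coalgebra k H }.

HB.mixin Record hasAntipode (k : fieldType) H of Bialgebra k H := {
  antipode : 'End(H);
  antipodel : forall x : H,
    tlift (fun u v => antipode u * v) (comul x) = counit x *: 1;
  antipoder : forall x : H,
    tlift (fun u v => u * antipode v) (comul x) = counit x *: 1
}.

#[short(type="hopfAlgType")]
HB.structure Definition HopfAlgebra (k : fieldType) :=
  { H of hasAntipode k H & Bialgebra k H }.

Section Coradical.
Variables (k : fieldType) (C : coalgType k).

Definition subcoalgebra (D : {vspace C}) : Prop :=
  (comul @: D <= tensv D D)%VS.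

Definition simple_subcoalgebra (D : {vspace C}) : Prop :=
  [/\ subcoalgebra D, D <> 0%VS
    & forall E, subcoalgebra E -> (E <= D)%VS -> E = 0%VS \/ E = D].

Definition coradical : {vspace C} := sumvs simple_subcoalgebra.

(* The term H_1 of the coradical filtration.                                 *)
Definition coradical1 : {vspace C} :=
  (comul @^-1: (tensv {:C} coradical + tensv coradical {:C}))%VS.

Definition pointed : Prop :=
  forall D : {vspace C}, simple_subcoalgebra D -> \dim D = 1%N.

Definition grouplike (g : C) : Prop := g <> 0 /\ comul g = g ⊗ g.

(* c is in P_{g,h}.                                                          *)
Definition skew_primitive (g h c : C) : Prop := comul c = c ⊗ g + h ⊗ c.

End Coradical.

Arguments coradical {k} C.
Arguments coradical1 {k} C.
Arguments pointed {k} C.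

Section Rank.
Variables (k : fieldType) (H : hopfAlgType k).

Definition skew_point (a : H) : Prop :=
  grouplike a /\ exists x, skew_primitive a 1 x /\ x \notin coradical H.

Definition skew_eigenvector (a : H) (N : nat) (q : k) (x : H) : Prop :=
  [/\ skew_primitive a 1 x, x \notin coradical H, N.-primitive_root q
    & a * x * a^-1 = q *: x].

(* The subspace of k (x) H_1 by which one divides to get the balanced tensor *)
(* product over H_0; here c . h = c * counit h.                              *)
Definition balancing : {vspace tensor k^o H} :=
  span_set (fun t => exists (c : k^o) (h v : H),
    [/\ h \in coradical H, v \in coradical1 H
      & t = (c * counit h) ⊗ v - c ⊗ (h * v)]).

(* k (x)_{H_0} H_1: the quotient of k (x) H_1 by balancing is realised as a  *)
(* complement, MathComp having no quotients of vector spaces.                *)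
Definition trivial_tensor : {vspace tensor k^o H} :=
  (tensv {:k^o} (coradical1 H) :\: balancing)%VS.

Definition has_rank (t : nat) : Prop := \dim trivial_tensor = t.+1.

End Rank.

Arguments has_rank {k} H t.

(* Main.v *)
From HB Require Import structures.
Require Import Defs.
From mathcomp Require Import all_boot all_order all_algebra all_field.
From mathcomp Require Import cyclic.

(** Conjugation by [a] acts on the space of skew primitive elements P_{a,1}, and
    the powers of [a] are group-like.  Distinct group-likes are linearly
    independent, so [a] has finite order [n].  As [p] does not divide [n], the
    field contains a primitive [n]-th root of unity and conjugation by [a] is
    diagonalizable on P_{a,1} ([finite_order_eigenvector]).  The eigenvectors
    span P_{a,1}, which is not contained in H_0, so one of them is outside H_0;
    its eigenvalue is an [n]-th root of unity.

    For uniqueness, the point is that rank one forces P_{a,1} to be at most one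
    dimensional modulo H_0 ([rank_one_skew_primitive]).  One has to see that no
    skew primitive element outside H_0 becomes trivial, or a multiple of the
    class of 1, in the tensor product of k and H_1 over H_0.  Since [H] is
    pointed, H_0 is the group algebra of the group-likes, and H_1 / H_0 is a Hopf
    module over it: for [v] in H_1 the class of Delta(v) modulo H (x) H_0 lies in
    H_0 (x) (H / H_0).  Its projection on coinvariants, which sends [v] to the
    class of S(v_(1)) v_(2), is [coinv] below.  It does not change when [v] is
    multiplied by a group-like ([coinv_grouplike_mul]); so it factors, as the
    counit does, through the tensor product over H_0.  The counit and [coinv]
    together send 1 to (1, 0) and a skew primitive [x] to (0, [x] modulo H_0).

    Consequently two eigenvectors [x] and [y] are related by [y = c x + h] with
    [h] in the intersection of P_{a,1} and H_0.  Such an [h] commutes with [a]: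
    H_0 is cocommutative, so that [(a - 1) ⊗ h = h ⊗ (a - 1)] and [h] is a
    multiple of [a - 1] unless [a = 1].  Comparing the eigenvalues of the three
    terms, the eigenvalue 1 of [h] differs from that of [x], whence [h = 0]. *)

Set Implicit Arguments.
Unset Strict Implicit.
Unset Printing Implicit Defensive.

Import GRing.Theory.
Local Open Scope ring_scope.

(** * Eigenvectors of operators of finite order *)

(** n being nonzero in k, X^n - 1 is separable, so that it has n distinct
    roots in k, and a field with n distinct n-th roots of unity has a primitive
    one. *)
Lemma closed_field_primitive_root (k : closedFieldType) n :
  (n%:R : k) != 0 -> exists w : k, n.-primitive_root w.
Proof.
move=> n0; have n_gt0 : (0 < n)%N by case: n n0 => //; rewrite eqxx.
have [r] := closed_field_poly_normal ('X^n - 1 : {poly k}).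
rewrite (monicP (monicXnsubC 1 n_gt0)) scale1r => rE.
have uniq_r : uniq r by rewrite -separable_prod_XsubC -rE separable_Xn_sub_1.
have size_r : size r = n.
  by apply: succn_inj; rewrite -(size_XnsubC (1 : k) n_gt0) rE size_prod_XsubC.
have/hasP[w _ pw] : has n.-primitive_root r; last by exists w.
apply: has_prim_root; rewrite ?size_r //; apply/allP => z rz.
by rewrite /root_of_unity /= rE root_prod_XsubC.
Qed.

Section LinearAlgebra.
Variables (k : fieldType) (V : vectType k).

(** An operator of order dividing n is diagonalizable when the field contains
    a primitive n-th root of unity w (whose existence forces n to be nonzero
    in the field).  The projections of x on the eigenspaces are combinations
    of iterates of f at x, so they belong to P; their sum x is not in U, so one
    of them is not in U. *)
Lemma finite_order_eigenvector (f : 'End(V)) (P U : {vspace V}) n (w : k) x :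
  n.-primitive_root w -> (f @: P <= P)%VS -> iter n f x = x ->
  x \in P -> x \notin U ->
  exists y q, [/\ y \in P, y \notin U, f y = q *: y & q ^+ n = 1].
Proof.
move=> prim_w fP fn Px Ux; have wn := prim_expr_order prim_w.
have n0 := prim_root_natf_neq0 prim_w.
have w_unit j : w ^+ j != 0.
  rewrite expf_neq0 //; apply/eqP=> w0; move: wn; rewrite w0 expr0n.
  rewrite -[n == 0]negbK -lt0n (prim_order_gt0 prim_w) => /eqP.
  by rewrite eq_sym oner_eq0.
(* y j is, up to the factor n, the projection of x on the eigenspace of     *)
(* (w ^+ j)^-1.                                                             *)
pose G j i := (w ^+ j) ^+ i *: iter i f x; pose y j := \sum_(i < n) G j i.
have Pit i : iter i f x \in P.
  by elim: i => // i IHi; apply: (subvP fP); rewrite memv_img.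
have fy j : f (y j) = (w ^+ j)^-1 *: y j.
  apply: (canRL (scalerK (w_unit j))); rewrite linear_sum scaler_sumr.
  have -> : y j = \sum_(i < n) G j i.+1.
    have Gn : G j n = G j 0 by rewrite /G fn exprAC wn expr1n expr0.
    apply: (@addrI _ (G j 0)); transitivity (\sum_(i < n.+1) G j i).
      by rewrite big_ord_recr /= Gn addrC.
    by rewrite big_ord_recl.
  by apply: eq_bigr => i _; rewrite linearZ /= scalerA -exprS.
have sum_y : \sum_(j < n) y j = n%:R *: x.
  have n_gt0 := prim_order_gt0 prim_w.
  rewrite exchange_big (bigD1 (Ordinal n_gt0)) //= [X in _ + X]big1 => [|i i0].
    rewrite addr0 -scaler_suml; congr (_ *: _).
    by under eq_bigr do rewrite expr0; rewrite sumr_const card_ord.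
  rewrite -scaler_suml; under eq_bigr do rewrite exprAC.
  have wi : w ^+ i != 1.
    by rewrite -(prim_order_dvd prim_w) gtnNdvd // lt0n.
  have /eqP := subrX1 (w ^+ i) n.
  rewrite exprAC wn expr1n subrr eq_sym mulf_eq0 subr_eq0 (negPf wi) => /eqP ->.
  by rewrite scale0r.
have [j Uy] : exists j : 'I_n, y j \notin U.
  apply/existsP; apply: contraR Ux; rewrite negb_exists => /forallP Uy.
  rewrite -[x]scale1r -(mulVf n0) -scalerA -sum_y memvZ // memv_suml // => j _.
  by have := Uy j; rewrite negbK.
exists (y j), (w ^+ j)^-1; split=> //.
  by rewrite memv_suml // => i _; rewrite memvZ.
by rewrite exprVn -exprM mulnC exprM wn expr1n invr1.
Qed.

Lemma sub_projv_lker (U : {vspace V}) : lker (\1 - projv U)%VF = U.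
Proof.
apply/vspaceP=> x; rewrite memv_ker add_lfunE opp_lfunE id_lfunE subr_eq0.
by apply/eqP/idP => [->|/projv_id->//]; apply: memv_proj.
Qed.

End LinearAlgebra.

(** * Linear maps on tensor products *)

HB.instance Definition _ (k : fieldType) (U V W : vectType k)
    (B : U -> V -> W) :=
  GRing.isLinear.Build k (tensor U V) W _ (tlift B) (tlift_linear B).

HB.instance Definition _ (k : fieldType) (U V U' V' : vectType k)
    (f : U -> U') (g : V -> V') :=
  GRing.Linear.copy (tmap f g) (tlift (fun u v => f u ⊗ g v)).

Section Tensors.
Variable k : fieldType.

Lemma span_set_sub (V : vectType k) (X : V -> Prop) (W : {vspace V}) :
  (forall v, X v -> v \in W) -> (span_set X <= W)%VS.
Proof. by move=> XW; apply: sumvs_sub => L [v Xv ->]; rewrite -memvE XW. Qed.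

Lemma tensv_sub (U V : vectType k) (A : {vspace U}) (B : {vspace V})
    (W : {vspace tensor U V}) :
  (forall u v, u \in A -> v \in B -> u ⊗ v \in W) -> (tensv A B <= W)%VS.
Proof.
by move=> ABW; apply: span_set_sub => t [u [v [Au Bv ->]]]; apply: ABW.
Qed.

Lemma tens_in_tensv (U V : vectType k) (A : {vspace U}) (B : {vspace V}) u v :
  u \in A -> v \in B -> u ⊗ v \in tensv A B.
Proof.
move=> Au Bv; rewrite memvE; apply: sumvs_sup.
by exists (u ⊗ v) => //; exists u, v.
Qed.

Lemma tensDl (U V : vectType k) (u u' : U) (v : V) :
  (u + u') ⊗ v = u ⊗ v + u' ⊗ v.
Proof. by have := (tens_bilinear U V).1 v 1 u u'; rewrite /= !scale1r. Qed.

Lemma tensZl (U V : vectType k) c (u : U) (v : V) : (c *: u) ⊗ v = c *: (u ⊗ v).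
Proof. by apply/matrixP=> i j; rewrite !mxE linearZ /= mulrA. Qed.

Lemma tensZr (U V : vectType k) c (u : U) (v : V) : u ⊗ (c *: v) = c *: (u ⊗ v).
Proof. by apply/matrixP=> i j; rewrite !mxE linearZ /= mulrCA. Qed.

(** This makes [tmul (a ⊗ b) t] linear in [a] and in [b], which enter it through
    the bilinear map that is lifted. *)
Lemma tlift_fun_linear (U V W : vectType k) (B B1 B2 : U -> V -> W) c t :
  (forall u v, B u v = c *: B1 u v + B2 u v) ->
  tlift B t = c *: tlift B1 t + tlift B2 t.
Proof.
move=> BE; rewrite /tlift scaler_sumr -big_split; apply: eq_bigr => i _ /=.
rewrite scaler_sumr -big_split; apply: eq_bigr => j _ /=.
by rewrite BE scalerDr !scalerA mulrC.
Qed.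

Lemma tmul_tensl (A : falgType k) (a b : A) (t : tensor A A) :
  tmul (a ⊗ b) t = tmap (amull a) (amull b) t.
Proof.
rewrite /tmul tlift_tens; last first.
  split=> [v c u u'|u c v v'] /=; apply: tlift_fun_linear => x y.
    by rewrite mulrDl -scalerAl (tens_bilinear A A).1.
  by rewrite mulrDl -scalerAl (tens_bilinear A A).2.
rewrite /tmap /tlift; apply: eq_bigr => i _; apply: eq_bigr => j _.
by rewrite !lfunE.
Qed.

Lemma tmap_tens (U V U' V' : vectType k) (f : 'Hom(U, U')) (g : 'Hom(V, V'))
    u v :
  tmap f g (u ⊗ v) = f u ⊗ g v.
Proof.
rewrite /tmap tlift_tens //; split=> [w c u1 u2|w c v1 v2] /=.
  by rewrite linearP (tens_bilinear U' V').1.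
by rewrite linearP (tens_bilinear U' V').2.
Qed.

Lemma tmul_tens (A : falgType k) (a b c d : A) :
  tmul (a ⊗ b) (c ⊗ d) = (a * c) ⊗ (b * d).
Proof. by rewrite tmul_tensl tmap_tens !lfunE. Qed.

Lemma tmulDl (A : falgType k) (s s' t : tensor A A) :
  tmul (s + s') t = tmul s t + tmul s' t.
Proof. exact: linearD. Qed.

Lemma tensBl (U V : vectType k) (u u' : U) (v : V) :
  (u - u') ⊗ v = u ⊗ v - u' ⊗ v.
Proof. by rewrite -scaleN1r tensDl tensZl scaleN1r. Qed.

Lemma tensBr (U V : vectType k) (u : U) (v v' : V) :
  u ⊗ (v - v') = u ⊗ v - u ⊗ v'.
Proof. by apply/matrixP=> i j; rewrite !mxE linearB /= mulrBr. Qed.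

(** A coordinate of [u] that does not vanish gives the proportionality factor. *)
Lemma tens_comm_line (V : vectType k) (u v : V) :
  u != 0 -> u ⊗ v = v ⊗ u -> v \in <[u]>%VS.
Proof.
move=> u0 /matrixP E.
have [i ci] : exists i, coord (vbasis {:V}) i u != 0.
  apply/existsP; apply: contraT; rewrite negb_exists => /forallP c0.
  case/eqP: u0; rewrite (coord_vbasis (memvf u)) big1 // => i _.
  by have := c0 i; rewrite negbK => /eqP ->; rewrite scale0r.
apply/vlineP; exists (coord (vbasis {:V}) i v / coord (vbasis {:V}) i u).
rewrite [LHS](coord_vbasis (memvf v)) [X in _ *: X](coord_vbasis (memvf u)).
rewrite scaler_sumr; apply: eq_bigr => j _.
rewrite scalerA mulrAC; congr (_ *: _).
have := E i j; rewrite !mxE => <-.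
by rewrite mulrAC mulfV ?mul1r.
Qed.

Definition tswap (V : vectType k) : tensor V V -> tensor V V :=
  tlift (fun u v => v ⊗ u).
HB.instance Definition _ (V : vectType k) := GRing.Linear.on (@tswap V).

Lemma tswap_tens (V : vectType k) (u v : V) : tswap (u ⊗ v) = v ⊗ u.
Proof.
rewrite /tswap tlift_tens //; split=> [w c x y|w c x y] /=.
  by rewrite (tens_bilinear V V).2.
by rewrite (tens_bilinear V V).1.
Qed.

End Tensors.

(** * Group-likes and the coradical of a coalgebra *)

Section Coalgebra.
Variable k : fieldType.

Lemma counit_bilinear (C : coalgType k) :
  @bilinear_map k C C C (fun u v => counit u *: v).
Proof.
split=> [v c u u'|u c v v'] /=; first by rewrite linearP scalerDl scalerA.
by rewrite scalerDr !scalerA mulrC.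
Qed.

Lemma counit_grouplike (C : coalgType k) (g : C) :
  grouplike g -> counit g = 1.
Proof.
case=> /eqP g0 Dg; have := counit_comull g; rewrite Dg.
rewrite tlift_tens; last exact: counit_bilinear.
move/eqP; rewrite -subr_eq0 -[X in _ - X]scale1r -scalerBl scaler_eq0.
by rewrite (negPf g0) orbF subr_eq0 => /eqP.
Qed.

Lemma grouplike_in_coradical (C : coalgType k) (g : C) :
  grouplike g -> g \in coradical C.
Proof.
move=> [/eqP g0 Dg]; rewrite memvE; apply: sumvs_sup; split.
- rewrite /subcoalgebra; apply/subvP=> _ /memv_imgP[_ /vlineP[c ->] ->].
  by rewrite linearZ /= Dg memvZ // tens_in_tensv ?memv_line.
- by apply/eqP; rewrite -dimv_eq0 dim_vline g0.
move=> E _ sEg; have [E0|E0] := eqVneq E 0%VS; [by left|right].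
apply/eqP; rewrite -(dimv_leqif_eq sEg) eqn_leq dimvS //= dim_vline g0.
by rewrite lt0n dimv_eq0.
Qed.

(** In a pointed coalgebra a simple subcoalgebra is a line spanned by some [v],
    with [comul v = c *: v ⊗ v]; the counit axiom makes [c] nonzero, and [c *: v]
    is group-like.  So the group-likes span the coradical. *)
Lemma coradical_sub (C : coalgType k) (W : {vspace C}) :
  pointed C -> (forall g, grouplike g -> g \in W) -> (coradical C <= W)%VS.
Proof.
move=> ptC gW; apply: sumvs_sub => D sD; have dimD := ptC D sD.
have /eqP := dimD; case: sD => subD /eqP D0 _ _.
pose v := vpick D; have vD : v \in D by apply: memv_pick.
have v0 : v != 0 by rewrite vpick0.
have DE : D = <[v]>%VS.
  apply/eqP; rewrite eq_sym -(dimv_leqif_eq (_ : _ <= D)%VS) -?memvE //.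
  by rewrite dim_vline v0 dimD.
have /vlineP[c Dv] : comul v \in <[v ⊗ v]>%VS.
  have := subvP subD (comul v) (memv_img _ vD); move: (comul v).
  apply/subvP/tensv_sub => u w; rewrite DE => /vlineP[b ->] /vlineP[d ->].
  by rewrite tensZl tensZr !memvZ ?memv_line.
have c0 : c != 0.
  apply: contraNneq v0 => c0; rewrite -(counit_comull v) Dv c0 scale0r.
  by rewrite linear0.
have /gW : grouplike (c *: v).
  split; first by apply/eqP; rewrite scaler_eq0 negb_or c0.
  by rewrite linearZ /= Dv tensZl tensZr.
by rewrite DE -memvE => /(memvZ c^-1); rewrite scalerA mulVf ?scale1r.
Qed.

Lemma coradical_eq_linear (C : coalgType k) (W : vectType k) (f g : C -> W) :
  pointed C -> linear f -> linear g ->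
  (forall x, grouplike x -> f x = g x) -> {in coradical C, f =1 g}.
Proof.
move=> ptC lf lg fg x C0x.
pose F : {linear C -> W} := HB.pack f (GRing.isLinear.Build k C W _ f lf).
pose G : {linear C -> W} := HB.pack g (GRing.isLinear.Build k C W _ g lg).
have FGE y : (linfun F - linfun G)%VF y = f y - g y.
  by rewrite add_lfunE opp_lfunE !lfunE.
have sC : (coradical C <= lker (linfun F - linfun G)%VF)%VS.
  apply: coradical_sub => // y gy.
  by rewrite memv_ker FGE fg // subrr.
by have := subvP sC x C0x; rewrite memv_ker FGE subr_eq0 => /eqP.
Qed.

Lemma coradical_cocommutative (C : coalgType k) :
  pointed C -> {in coradical C, forall x, tswap (comul x) = comul x}.
Proof.
move=> ptC; apply: coradical_eq_linear => // [c x y|c x y|g [_ Dg]].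
- by rewrite !linearP.
- by rewrite linearP.
by rewrite Dg tswap_tens.
Qed.

(** This amounts to the linear independence of distinct group-likes.  If c_i is
    the coordinate of g on X`_i, applying coord X i to the first factor of the
    comultiplication of g gives c_i *: g, and applying it to the expansion of
    the same tensor gives c_i *: X`_i.  Some c_i is nonzero. *)
Lemma grouplike_in_span (C : coalgType k) n (X : n.-tuple C) (g : C) :
  (forall i : 'I_n, grouplike X`_i) -> free X -> grouplike g ->
  g \in <<X>>%VS -> exists i : 'I_n, g = X`_i.
Proof.
move=> gX frX gg gS.
have [i ci0] : exists i : 'I_n, coord X i g != 0.
  apply/existsP; apply: contraT; rewrite negb_exists => /forallP c0.
  case: gg.1; rewrite (coord_span gS) big1 // => i _.
  by have := c0 i; rewrite negbK => /eqP ->; rewrite scale0r.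
exists i; pose B (u v : C) := coord X i u *: v.
have bB : bilinear_map B.
  rewrite /B; split=> [v c u u'|u c v v'] /=.
    by rewrite linearP scalerDl scalerA.
  by rewrite scalerDr !scalerA mulrC.
have := congr1 (fun u => tlift B (comul u)) (coord_span gS).
rewrite gg.2 tlift_tens // !linear_sum (bigD1 i) //= big1 => [|j ji].
  rewrite addr0 !linearZ /= (gX i).2 tlift_tens // /B coord_free // eqxx.
  rewrite scale1r => /(congr1 (fun u => (coord X i g)^-1 *: u)).
  by rewrite !scalerA mulVf // !scale1r.
rewrite !linearZ /= (gX j).2 tlift_tens // /B coord_free //.
by rewrite (negPf ji) scale0r scaler0.
Qed.

End Coalgebra.

(** * Group-likes and skew primitive elements of a Hopf algebra *)

Section Hopf.
Variables (k : fieldType) (H : hopfAlgType k).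
Implicit Types (g a x y : H).

Lemma grouplike1 : grouplike (1 : H).
Proof. by split; [apply/eqP/oner_neq0 | apply: comul1]. Qed.

Lemma grouplike_antipode g :
  grouplike g -> antipode g * g = 1 /\ g * antipode g = 1.
Proof.
move=> gg; have := antipodel g; have := antipoder g.
rewrite (counit_grouplike gg) !scale1r gg.2 !tlift_tens //.
  split=> [v c u u'|u c v v'] /=; rewrite ?linearP /=.
    by rewrite mulrDl -scalerAl.
  by rewrite mulrDr -scalerAr.
split=> [v c u u'|u c v v'] /=; rewrite ?linearP /=.
  by rewrite mulrDl -scalerAl.
by rewrite mulrDr -scalerAr.
Qed.

Lemma grouplike_unit g : grouplike g -> g \is a GRing.unit.
Proof.
by move=> /grouplike_antipode[Sg gS]; apply/unitrP; exists (antipode g).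
Qed.

Lemma antipode_grouplike g : grouplike g -> antipode g = g^-1.
Proof.
move=> gg; have [Sg _] := grouplike_antipode gg.
by apply: (mulIr (grouplike_unit gg)); rewrite Sg mulVr ?grouplike_unit.
Qed.

Lemma grouplikeM g h : grouplike g -> grouplike h -> grouplike (g * h).
Proof.
move=> gg gh; split; last by rewrite comulM gg.2 gh.2 tmul_tens.
have: g * h \is a GRing.unit by rewrite unitrMl grouplike_unit.
by move=> U E; rewrite E unitr0 in U.
Qed.

Lemma grouplikeX g n : grouplike g -> grouplike (g ^+ n).
Proof.
move=> gg; elim: n => [|n IHn]; first exact: grouplike1.
by rewrite exprS; apply: grouplikeM.
Qed.

(** Let [m] be the least exponent for which the powers of [a] up to [a ^+ m] are
    linearly dependent.  Then [a ^+ m] is in the span of the independent powers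
    before it, hence is equal to one of them. *)
Lemma grouplike_finite_order a :
  grouplike a -> exists n, (0 < n)%N /\ a ^+ n = 1.
Proof.
move=> ga; pose X m := [tuple a ^+ (i : 'I_m) | i < m].
have XE m (i : 'I_m) : (X m)`_i = a ^+ i.
  by rewrite -tnth_nth tnth_mktuple.
have not_free : exists m, ~~ free (X m).
  exists (\dim {:H}).+1; apply/negP; rewrite /free size_tuple => /eqP E.
  by have := dimvS (subvf <<X (\dim {:H}).+1>>%VS); rewrite E ltnn.
case: (ex_minnP not_free) => [[|m]]; first by rewrite tuple0 nil_free.
move=> nfr min_m.
have frm : free (X m) by apply: contraT => /min_m; rewrite ltnn.
have XS : X m.+1 = rcons (X m) (a ^+ m) :> seq H.
  apply: (@eq_from_nth _ 0); rewrite ?size_rcons !size_tuple // => i lim.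
  rewrite (XE _ (Ordinal lim)) nth_rcons size_tuple /=.
  have := lim; rewrite ltnS leq_eqVlt => /predU1P[->|im].
    by rewrite ltnn eqxx.
  by rewrite im (XE _ (Ordinal im)).
have am : a ^+ m \in <<X m>>%VS.
  apply: contraR nfr => am; rewrite XS.
  by rewrite -(perm_free (_ : perm_eq (a ^+ m :: X m) _)) ?free_cons ?am //
             perm_sym perm_rcons.
have gXm (i : 'I_m) : grouplike (X m)`_i by rewrite XE; apply: grouplikeX.
have [i] := grouplike_in_span gXm frm (grouplikeX m ga) am.
rewrite XE => ami; exists (m - i)%N; rewrite subn_gt0 ltn_ord; split=> //.
apply: (mulIr (grouplike_unit (grouplikeX i ga))).
by rewrite -exprD subnK ?mul1r // ltnW.
Qed.

Lemma grouplikeV g : grouplike g -> grouplike g^-1.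
Proof.
move=> gg; have [[|n] [//] _ gn] := grouplike_finite_order gg.
suff -> : g^-1 = g ^+ n by apply: grouplikeX.
apply: (mulIr (grouplike_unit gg)).
by rewrite mulVr ?grouplike_unit // -exprSr.
Qed.

Lemma skew_primitive_conj g h x :
  grouplike g -> skew_primitive g h x -> g * h = h * g ->
  skew_primitive g h (g * x * g^-1).
Proof.
move=> gg px gh; have gU := grouplike_unit gg; rewrite /skew_primitive.
rewrite !comulM gg.2 (grouplikeV gg).2 px tmul_tensl linearD /=.
rewrite !(tmap_tens (amull g) (amull g)) !lfunE /= tmulDl !tmul_tens gh.
by rewrite !mulrK.
Qed.

Definition skew_space (g h : H) : {vspace H} :=
  lker (comul - linfun (fun x : H => x ⊗ g + h ⊗ x))%VF.

Lemma skew_spaceP g h x : reflect (skew_primitive g h x) (x \in skew_space g h).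
Proof.
have lin : linear (fun x : H => x ⊗ g + h ⊗ x).
  move=> c u v; rewrite (tens_bilinear H H).1 (tens_bilinear H H).2.
  by rewrite scalerDr addrACA.
pose f : {linear H -> tensor H H} :=
  HB.pack (fun x : H => x ⊗ g + h ⊗ x) (GRing.isLinear.Build k H _ _ _ lin).
rewrite /skew_space memv_ker add_lfunE opp_lfunE (lfunE f) subr_eq0.
exact: eqP.
Qed.

(** * The coinvariants of the first term of the coradical filtration *)

Section PointedHopf.
Hypothesis pointed_H : pointed H.
Local Notation H0 := (coradical H).

Lemma coradicalM x y : x \in H0 -> y \in H0 -> x * y \in H0.
Proof.
move=> H0x H0y; suff /subvP/(_ x H0x): (H0 <= amulr y @^-1: H0)%VS.
  by rewrite -memv_preim lfunE.
apply: coradical_sub => // g gg; rewrite -memv_preim lfunE /=.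
suff /subvP/(_ y H0y): (H0 <= amull g @^-1: H0)%VS by rewrite -memv_preim lfunE.
apply: coradical_sub => // h gh; rewrite -memv_preim lfunE /=.
exact/grouplike_in_coradical/grouplikeM.
Qed.

Lemma antipode_coradical x : x \in H0 -> antipode x \in H0.
Proof.
move=> H0x; suff /subvP/(_ x H0x): (H0 <= antipode @^-1: H0)%VS.
  by rewrite -memv_preim.
apply: coradical_sub => // g gg; rewrite -memv_preim antipode_grouplike //.
exact/grouplike_in_coradical/grouplikeV.
Qed.

(** As H_0 is cocommutative, [(a - 1) ⊗ x = x ⊗ (a - 1)], and [x] is on the line
    of [a - 1] unless [a = 1]. *)
Lemma coradical_skew_primitive_comm a x :
  skew_primitive a 1 x -> x \in H0 -> a * x = x * a.
Proof.
move=> px H0x; have := coradical_cocommutative pointed_H H0x.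
rewrite px linearD /= !tswap_tens => E.
have {}E : (a - 1) ⊗ x = x ⊗ (a - 1).
  by rewrite tensBl tensBr; apply/eqP; rewrite subr_eq addrAC -E addrK.
have [->|a1] := eqVneq a 1; first by rewrite mul1r mulr1.
rewrite -subr_eq0 in a1; have /vlineP[c ->] := tens_comm_line a1 E.
by rewrite -scalerAr -scalerAl mulrBr mulrBl mulr1 mul1r.
Qed.

(* For u in H0 this is S(u) v.  Another choice of the projection changes the  *)
(* value of tlift B at the comultiplication of an element of H_1 only by an   *)
(* element of H0.                                                             *)
Let B (u v : H) : H := antipode (projv H0 u) * v.

Let B_bilinear : bilinear_map B.
Proof.
rewrite /B; split=> [v c u u'|u c v v'] /=.
  by rewrite !linearP mulrDl -scalerAl.
by rewrite mulrDr -scalerAr.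
Qed.

(* The quotient map from H to H / H0, up to the embedding of its target in H. *)
Variable mod_H0 : 'End(H).
Hypothesis lker_mod_H0 : lker mod_H0 = H0.

Let mod_H0E x : (mod_H0 x == 0) = (x \in H0).
Proof. by rewrite -lker_mod_H0 memv_ker. Qed.

(** On H_1 this is the canonical projection of the Hopf module H_1 / H_0 over H_0
    on its coinvariants, [v] being sent to S(v_(1)) v_(2) modulo H_0. *)
Definition coinv : 'End(H) := (mod_H0 \o linfun (tlift B) \o comul)%VF.

Lemma coinvE x : coinv x = mod_H0 (tlift B (comul x)).
Proof. by rewrite /coinv !comp_lfunE lfunE. Qed.

Lemma coinv_skew_primitive a x :
  grouplike a -> skew_primitive a 1 x -> coinv x = mod_H0 x.
Proof.
move=> ga px; rewrite coinvE px linearD /= !tlift_tens //.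
rewrite /B (projv_id (grouplike_in_coradical grouplike1)).
rewrite (antipode_grouplike grouplike1) invr1 mul1r.
rewrite linearD /= -[RHS]add0r; congr (_ + _); apply/eqP; rewrite mod_H0E.
rewrite coradicalM ?antipode_coradical ?memv_proj //.
exact: grouplike_in_coradical.
Qed.

Lemma coinv_coradical x : x \in H0 -> coinv x = 0.
Proof.
move=> H0x; suff /subvP/(_ x H0x): (H0 <= lker coinv)%VS.
  by rewrite memv_ker => /eqP.
apply: coradical_sub => // g gg; rewrite memv_ker coinvE gg.2 tlift_tens //.
rewrite mod_H0E coradicalM ?antipode_coradical ?memv_proj //.
exact: grouplike_in_coradical.
Qed.

(** The comultiplication of [v] lies in H (x) H_0 + H_0 (x) H.  The first summand
    contributes nothing modulo H_0, as H_0 is closed under product and antipode.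
    On [u ⊗ w] with [u] in H_0, the factors [g] cancel, since
    S(g u) g w = S(u) S(g) g w = S(u) w. *)
Lemma coinv_grouplike_mul g v :
  grouplike g -> v \in coradical1 H -> coinv (g * v) = coinv v.
Proof.
move=> gg H1v; rewrite !coinvE comulM gg.2 tmul_tensl.
pose Bf := (mod_H0 \o linfun (tlift B))%VF.
pose f := (Bf \o linfun (tmap (amull g) (amull g)) - Bf)%VF.
have fE t : f t =
    mod_H0 (tlift B (tmap (amull g) (amull g) t)) - mod_H0 (tlift B t).
  by rewrite add_lfunE opp_lfunE !comp_lfunE !lfunE.
suff /subvP/(_ (comul v)) :
    (tensv {:H} (coradical H) + tensv (coradical H) {:H} <= lker f)%VS.
  by rewrite memv_preim => /(_ H1v); rewrite memv_ker fE subr_eq0 => /eqP.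
have H0g := grouplike_in_coradical gg.
have fT u w : f (u ⊗ w) = mod_H0 (B (g * u) (g * w)) - mod_H0 (B u w).
  by rewrite fE (tmap_tens (amull g) (amull g)) !tlift_tens // !lfunE.
rewrite subv_add; apply/andP; split; apply: tensv_sub => u w.
  move=> _ H0w; rewrite memv_ker fT /B.
  have H0S y z : z \in H0 -> mod_H0 (antipode (projv H0 y) * z) = 0.
    move=> H0z; apply/eqP.
    by rewrite mod_H0E coradicalM ?antipode_coradical ?memv_proj.
  by rewrite !H0S ?subrr // coradicalM.
move=> H0u _; rewrite memv_ker fT /B.
rewrite !projv_id ?coradicalM // subr_eq0; apply/eqP; congr (mod_H0 _).
move: u H0u.
apply: coradical_eq_linear => // [c x y|c x y|u gu].
- by rewrite mulrDr -scalerAr linearP mulrDl -scalerAl.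
- by rewrite linearP mulrDl -scalerAl.
rewrite !antipode_grouplike //; last exact: grouplikeM.
by rewrite invrM ?grouplike_unit // mulrA divrK ?grouplike_unit.
Qed.

Lemma coinv_mul h v :
  h \in H0 -> v \in coradical1 H -> coinv (h * v) = counit h *: coinv v.
Proof.
move=> H0h H1v; move: h H0h.
apply: coradical_eq_linear => // [c x y|c x y|g gg].
- by rewrite mulrDl -scalerAl linearP.
- by rewrite linearP scalerDl scalerA.
by rewrite coinv_grouplike_mul // counit_grouplike // scale1r.
Qed.

End PointedHopf.

(** * Skew primitive elements in rank one *)

Lemma counit_skew_primitive a x :
  grouplike a -> skew_primitive a 1 x -> counit x = 0.
Proof.
move=> [/eqP a0 Da] px; have := counit_comull x; rewrite px linearD /=.
rewrite !tlift_tens; try exact: counit_bilinear.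
rewrite counit1 scale1r => /eqP.
by rewrite -subr_eq0 addrK scaler_eq0 (negPf a0) orbF => /eqP.
Qed.

Lemma skew_primitive_coradical1 a x :
  grouplike a -> skew_primitive a 1 x -> x \in coradical1 H.
Proof.
move=> ga px; rewrite -memv_preim px memv_add // tens_in_tensv ?memvf //.
  exact: grouplike_in_coradical.
exact/grouplike_in_coradical/grouplike1.
Qed.

(** The map [F] induced by the counit and [coinv] vanishes on [balancing], so that
    its image on k (x) H_1 has dimension at most 2.  The images (1, 0) of 1 and
    (0, [r x]) of [x] are independent, hence span it, and the image (0, [r y]) of
    [y] is then a multiple of the latter. *)
Lemma rank_one_skew_primitive a x y :
  pointed H -> has_rank H 1 -> grouplike a ->
  skew_primitive a 1 x -> x \notin coradical H -> skew_primitive a 1 y ->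
  exists c, y - c *: x \in coradical H.
Proof.
move=> ptH rk1 ga px H0x py.
pose r : 'End(H) := (\1 - projv (coradical H))%VF.
have ker_r : lker r = coradical H by apply: sub_projv_lker.
pose B (c : k^o) (h : H) : k^o * H := (c * counit h, c *: coinv r h).
have bB : bilinear_map B.
  split=> [v c u u'|u c v v']; rewrite /B /=.
    by congr (_, _); rewrite ?mulrDl ?scalerDl -?scalerA // -scalerAl.
  congr (_, _); first by rewrite linearP /= mulrDr scalerAr.
  by rewrite linearP /= scalerDr !scalerA mulrC.
pose F : 'Hom(tensor k^o H, (k^o * H)%type) := linfun (tlift B).
have FE c h : F (c ⊗ h) = B c h by rewrite lfunE /= tlift_tens.
have balF : (balancing H <= lker F)%VS.
  apply: span_set_sub => _ [c [h [v [H0h H1v ->]]]].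
  rewrite memv_ker linearB /= !FE /B counitM (coinv_mul ptH ker_r) //.
  by rewrite scalerA mulrA subrr.
pose W := tensv {:k^o} (coradical1 H).
have dimFW : (\dim (F @: W) <= 2)%N.
  rewrite -rk1 /trivial_tensor -/W -{1}(addv_diff_cap W (balancing H)) limgD.
  have -> : (F @: (W :&: balancing H))%VS = 0%VS.
    by apply/eqP; rewrite -lkerE (subv_trans (capvSr _ _)).
  by rewrite addv0 -(limg_ker_dim F (W :\: _)%VS) leq_addl.
have WF v : v \in coradical1 H -> B 1 v \in (F @: W)%VS.
  by move=> H1v; rewrite -FE memv_img // tens_in_tensv ?memvf.
have B1 : B 1 1 = (1, 0).
  rewrite /B counit1 mulr1 scale1r (coinv_coradical ptH ker_r) //.
  exact/grouplike_in_coradical/grouplike1.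
have Bs z : skew_primitive a 1 z -> B 1 z = (0, r z).
  move=> pz; rewrite /B (counit_skew_primitive ga pz) mulr0 scale1r.
  by rewrite (coinv_skew_primitive ptH ker_r ga pz).
have H1s z : skew_primitive a 1 z -> B 1 z \in (F @: W)%VS.
  by move=> pz; apply/WF/(skew_primitive_coradical1 ga).
have rx0 : r x != 0 by rewrite -memv_ker ker_r.
have fr : free [:: B 1 1; B 1 x].
  rewrite free_cons span_seq1 seq1_free B1 Bs //.
  apply/andP; split; last by rewrite -pair_eqE /= negb_and rx0 orbT.
  apply/vlineP=> -[c /(congr1 fst)] /= /eqP; rewrite scaler0.
  by rewrite oner_eq0.
have sFW : (<<[:: B 1%R 1%R; B 1%R x]>> <= F @: W)%VS.
  apply/span_subvP => z; rewrite !inE => /pred2P[] ->; last exact: H1s.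
  apply: WF; rewrite -memv_preim comul1 memvE.
  apply: subv_trans (addvSl _ _); rewrite -memvE tens_in_tensv ?memvf //.
  exact/grouplike_in_coradical/grouplike1.
have /eqP spanE : (<<[:: B 1%R 1%R; B 1%R x]>> == F @: W)%VS.
  by rewrite -(dimv_leqif_eq sFW) eqn_leq dimvS // (eqP fr).
have := H1s y py; rewrite -spanE span_cons span_seq1.
case/memv_addP=> _ /vlineP[c ->] [_ /vlineP[d ->]].
rewrite B1 !Bs // => /(congr1 snd) /= E; exists d.
by rewrite -ker_r memv_ker linearB linearZ /= E scaler0 add0r subrr.
Qed.

End Hopf.

(** * Skew eigenvectors *)

Theorem lemma3p1 (k : closedFieldType) (p : nat) (char_k : p \in [pchar k])
    (H : hopfAlgType k) (pointed_H : pointed H)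
    (H_neq_H0 : coradical H <> {:H}%VS)
    (a : H) (a_skew : skew_point a)
    (a_order : forall n : nat, n.-primitive_root a -> ~~ (p %| n)%N) :
  (exists (x : H) (q : k) (N : nat), skew_eigenvector a N q x) /\
  (forall (x : H) (q : k) (N : nat),
     skew_eigenvector a N q x -> q <> 1 -> has_rank H 1 ->
     forall (y : H) (q' : k) (N' : nat),
       skew_eigenvector a N' q' y -> exists c : k, y = c *: x).
Proof.
have [ga [z [pz H0z]]] := a_skew; have aU := grouplike_unit ga; split.
  have [m [m_gt0 am]] := grouplike_finite_order ga.
  have [n prim_a _] := prim_order_exists m_gt0 am.
  have n0 : (n%:R : k) != 0 by rewrite -(dvdn_pcharf char_k) a_order.
  have [w prim_w] := closed_field_primitive_root n0.
  pose f : 'End(H) := (amulr (a^-1)%R \o amull a)%VF.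
  have fE x : f x = a * x * a^-1 by rewrite comp_lfunE !lfunE.
  have fP : (f @: skew_space a 1%R <= skew_space a 1%R)%VS.
    apply/subvP=> _ /memv_imgP[x /skew_spaceP px ->]; apply/skew_spaceP.
    by rewrite fE; apply: skew_primitive_conj; rewrite ?mulr1 ?mul1r.
  have fn : iter n f z = z.
    have -> : iter n f z = a ^+ n * z * a ^- n.
      elim: n {prim_a n0 prim_w} => [|n IHn]; first by rewrite invr1 mul1r mulr1.
      by rewrite /= IHn fE exprS invrM ?unitrX // !mulrA.
    by rewrite (prim_expr_order prim_a) invr1 mul1r mulr1.
  have [x [q [/skew_spaceP px H0x fx qn]]] :=
    finite_order_eigenvector prim_w fP fn (introT (skew_spaceP _ _ _) pz) H0z.
  have [N prim_q _] := prim_order_exists (prim_order_gt0 prim_w) qn.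
  by exists x, q, N; split; rewrite // -fE.
move=> x q N [px H0x _ ax] q1 rk1 y q' N' [py H0y _ ay].
have [c H0yx] := rank_one_skew_primitive pointed_H rk1 ga px H0x py.
set h := y - c *: x in H0yx.
have ph : skew_primitive a 1 h.
  by apply/skew_spaceP; rewrite memvB ?memvZ //; apply/skew_spaceP.
have ah : a * h * a^-1 = h.
  by rewrite (coradical_skew_primitive_comm pointed_H ph H0yx) mulrK.
have yE : y = c *: x + h by rewrite addrC subrK.
(* Conjugating y = c *: x + h multiplies y by q', x by q and h by 1. *)
have E : (c * (q' - q)) *: x = (1 - q') *: h.
  move: ay; rewrite yE mulrDr mulrDl ah -scalerAr -scalerAl ax scalerDr !scalerA.
  move=> {}ay; apply/eqP; rewrite mulrBr !scalerBl scale1r subr_eq.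
  by rewrite addrAC [h + _]addrC ay [q' * c]mulrC addrK.
exists c; rewrite yE; suff -> : h = 0 by rewrite addr0.
have c0 : c != 0 by apply: contraNneq H0y => c0; rewrite yE c0 scale0r add0r.
have /eqP : c * (q' - q) == 0.
  apply: contraR H0x => nz; rewrite -[x]scale1r -(mulVf nz) -scalerA E.
  by rewrite !memvZ.
move=> cq; move/eqP: (E).
rewrite cq scale0r eq_sym scaler_eq0 => /predU1P[|/eqP//].
move/eqP: cq; rewrite mulf_eq0 (negPf c0) subr_eq0 => /eqP ->.
by move/eqP; rewrite subr_eq0 eq_sym => /eqP.
Qed.
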